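(* Let $d\ge 2$. There exist $d$ injective order-preserving maps $Z_j:\mathbb{Q}/\mathbb{Z}\to\mathbb{Q}/\mathbb{Z}$, $j=0,1,\dots,d-1$, such that for every $\theta\in\mathbb{Q}/\mathbb{Z}$ and every $j$ the spiders $S_d(\theta)$ and $S_{d+1}(Z_j(\theta))$ are isomorphic.
   Context: The linear order on $\mathbb{R}/\mathbb{Z}$ is the one induced by identification with $[0,1)$. For $d\ge2$ and $\theta\in\mathbb{Q}/\mathbb{Z}$, the degree-$d$ spider is the following subset of the Riemann sphere. If $\theta$ is strictly preperiodic under multiplication by $d$, $S_d(\theta)=\bigcup_{j\ge1}\{re^{2\pi i d^{j-1}\theta}: r\in[1,\infty]\}$. If $\theta$ is periodic of period $k$, $S_d(\theta)$ is this set together with $\{re^{2\pi i d^{k-1}\theta}:r\in[0,1]\}$. A leg of $S_d(\theta)$ is a connected component of $S_d(\theta)\setminus\{\infty\}$; so the legs correspond to the distinct angles in the orbit $\{d^{n-1}\theta:n\ge1\}$. Spiders $S_d(\theta)$ and $S_{d'}(\theta')$ are isomorphic if, writing $\theta_n=d^{n-1}\theta$ and $\theta'_n=(d')^{n-1}\theta'$: (i) they have the same number $r$ of legs; (ii) if the counterclockwise order of the angles of the legs of $S_d(\theta)$ is $(\theta_{n_1},\theta_{n_2},\dots,\theta_{n_r})$, then the corresponding counterclockwise order in $S_{d'}(\theta')$ is $(\theta'_{n_1},\theta'_{n_2},\dots,\theta'_{n_r})$. *)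

(* Defs.v *)
From HB Require Import structures.
From mathcomp Require Import all_boot all_order all_algebra archimedean.
From mathcomp Require Import all_classical all_reals all_analysis.

Set Implicit Arguments.
Unset Strict Implicit.
Unset Printing Implicit Defensive.

Import Order.TTheory GRing.Theory Num.Theory.
Import numFieldNormedType.Exports.

Local Open Scope classical_set_scope.
Local Open Scope ring_scope.

(* Q/Z, each class being given by its representative in [0, 1); the order is
   that of the representatives. *)
Record QZ : Type := MkQZ { qz_val : rat; qz_valP : 0 <= qz_val < 1 }.

HB.instance Definition _ := [isSub for qz_val].
HB.instance Definition _ := [Choice of QZ by <:].
HB.instance Definition _ := [SubChoice_isSubOrder of QZ by <: with ring_display].

Lemma frac_itv (x : rat) : 0 <= x - (Num.floor x)%:~R < 1.
Proof.
have /andP[h1 h2] := floor_itv x.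
by rewrite subr_ge0 h1 /= ltrBlDl -intrD1.
Qed.

Definition qz_class (x : rat) : QZ := MkQZ (frac_itv x).

Definition qz_muln (n : nat) (t : QZ) : QZ := qz_class (n%:R * qz_val t).

(* theta_n = d^(n-1) theta, meaningful for n >= 1 only. *)
Definition orbit_angle (d : nat) (theta : QZ) (n : nat) : QZ :=
  qz_muln (d ^ n.-1) theta.

Definition is_period (d : nat) (theta : QZ) (k : nat) : Prop :=
  [/\ (0 < k)%N, qz_muln (d ^ k) theta = theta &
      forall m, (0 < m < k)%N -> qz_muln (d ^ m) theta <> theta].

Section Spiders.
Variable R : realType.

(* The complex plane is R * R with its product topology, x + i y being (x, y);
   the point at infinity of the sphere is None. *)
Definition riemann_sphere : topologicalType :=
  one_point_compactification (R * R)%type.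

Definition infinity_pt : riemann_sphere := None.

(* The point r e^(2 pi i t); used for 0 <= r <= +oo only. *)
Definition polar_pt (r : \bar R) (t : QZ) : riemann_sphere :=
  if r is r'%:E then
    Some (r' * cos (2 * pi * ratr (qz_val t)), r' * sin (2 * pi * ratr (qz_val t)))
  else infinity_pt.

(* The second set is empty when theta is strictly preperiodic, and otherwise is
   the segment of angle d^(k-1) theta with k the period of theta. *)
Definition spider (d : nat) (theta : QZ) : set riemann_sphere :=
  [set z | exists j r, [/\ (1 <= j)%N, (1 <= r)%E &
             z = polar_pt r (qz_muln (d ^ j.-1) theta)]] `|`
  [set z | exists k r, [/\ is_period d theta k, (0 <= r <= 1)%E &
             z = polar_pt r (qz_muln (d ^ k.-1) theta)]].

Definition legs (d : nat) (theta : QZ) : set (set riemann_sphere) :=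
  let S := spider d theta `\ infinity_pt in
  [set connected_component S z | z in S].

(* A leg lies on a ray from 0 and meets the unit circle exactly once, at the
   point giving its angle. *)
Definition leg_angles (d : nat) (theta : QZ) : set QZ :=
  [set t | exists2 L, legs d theta L & L (polar_pt 1%:E t)].

(* Counterclockwise order is a cyclic order: a listing may start anywhere. *)
Definition counterclockwise (s : seq QZ) : Prop :=
  exists i : nat, sorted <%O (rot i s).

(* (theta_n | n <- ns) lists every leg angle once, in counterclockwise order. *)
Definition leg_order (d : nat) (theta : QZ) (ns : seq nat) : Prop :=
  [/\ all (leq 1) ns,
      leg_angles d theta = [set` [seq orbit_angle d theta n | n <- ns]] &
      counterclockwise [seq orbit_angle d theta n | n <- ns]].

Definition spider_isomorphic (d : nat) (theta : QZ) (d' : nat) (theta' : QZ) :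
    Prop :=
  (exists r : nat, (legs d theta #= `I_r)%card /\ (legs d' theta' #= `I_r)%card) /\
  (forall ns : seq nat, leg_order d theta ns -> leg_order d' theta' ns).

End Spiders.

(* Main.v *)
Require Import Defs.
From mathcomp Require Import all_boot all_order all_algebra archimedean.
From mathcomp Require Import all_classical all_reals all_analysis.
From mathcomp Require Import ring lra zify.

(** Write an angle of Q/Z by its base-d expansion, the one that does not end in
    repeated digits d-1, and rename its digits by the increasing map from
    [0, d) to [0, d+1) that skips the value j.  Reading the result in base d+1
    gives Z_j.  Renaming digits commutes with the shift of the expansion, and
    the shift is multiplication by the base, so Z_j (d t) = (d+1) Z_j t; since
    the renaming is increasing, comparing first distinct digits shows that Z_j
    is strictly increasing on [0, 1).  Hence Z_j carries the orbit of t under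
    multiplication by d onto the orbit of Z_j t under multiplication by d+1,
    matching the times and the order of the angles ([recode_qz_muln],
    [recode_lt]).  For i < j the maps Z_i and Z_j differ, because they send
    the digit i to i+1 and to i.

    Infinite expansions are never summed.  The value w of the renamed expansion
    of t is characterised by a bounded solution u of the recursion
    B u_n = (renamed n-th digit) + u_(n+1) with u_0 = w, unique because the
    recursion multiplies the difference of two solutions by B.  A rational
    solution exists because every angle of Q/Z is preperiodic: a periodic
    expansion is a geometric series, and digits can be prepended one by one.

    What remains is to recover a spider from its orbit of angles.  Away from
    infinity the spider is a finite union of closed half-lines, one for each
    angle of the orbit, starting on the unit circle or, for at most one of them,
    at the origin.  They are connected and pairwise disjoint, and a finite union
    of disjoint closed sets makes each of them open in the union; so they are
    the connected components ([legs_card_orbit], [leg_angles_orbit]). *)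

Set Implicit Arguments.
Unset Strict Implicit.
Unset Printing Implicit Defensive.

Import Order.TTheory GRing.Theory Num.Theory.
Import numFieldNormedType.Exports.

Local Open Scope classical_set_scope.
Local Open Scope ring_scope.

Implicit Types (d n : nat) (s t : QZ).

(** * Multiplication on Q/Z and base-d digits *)

Lemma qz_val_ge0 t : 0 <= qz_val t.
Proof. by case/andP: (qz_valP t). Qed.

Lemma qz_val_lt1 t : qz_val t < 1.
Proof. by case/andP: (qz_valP t). Qed.

Lemma qz_val_inj : injective qz_val.
Proof. exact: (@val_inj _ _ QZ). Qed.

Lemma lt_qz s t : (s < t)%O = (qz_val s < qz_val t).
Proof. by []. Qed.

Lemma qz_classDz (x : rat) (m : int) : qz_class (x + m%:~R) = qz_class x.
Proof.
apply: qz_val_inj; rewrite /= floorDrz ?intr_int// intrKfloor rmorphD/=.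
by rewrite opprD addrACA subrr addr0.
Qed.

Lemma qz_mul1n t : qz_muln 1 t = t.
Proof.
apply: qz_val_inj; rewrite /= mul1r (floor_def (m := 0)) ?subr0//.
by rewrite add0r qz_valP.
Qed.

Lemma qz_mulnM d n t : qz_muln (d * n) t = qz_muln d (qz_muln n t).
Proof.
rewrite [RHS]/qz_muln /= mulrBr mulrA -natrM.
set m := Num.floor _.
have -> : d%:R * m%:~R = (d%:Z * m)%:~R :> rat by rewrite rmorphM.
by rewrite -rmorphN/= qz_classDz.
Qed.

Lemma qz_mulnX d n t : qz_muln (d ^ n) t = iter n (qz_muln d) t.
Proof. by elim: n => [|n IH]; rewrite ?expn0 ?qz_mul1n// expnS qz_mulnM IH. Qed.

(** Multiples of a fraction of denominator q are fractions of denominator q,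
    of which [0, 1) contains only q. *)
Lemma qz_muln_finite t : finite_set (range (qz_muln ^~ t)).
Proof.
pose q := `|denq (qz_val t)|%N; pose a := `|numq (qz_val t)|%N.
have q0 : (0 < q)%N by rewrite absz_gt0 denq_eq0.
have tE : qz_val t = a%:R / q%:R.
  rewrite -[LHS]divq_num_den /a /q !natr_absz [`|denq _|]gtr0_norm//.
  by rewrite ger0_norm// numq_ge0 qz_val_ge0.
apply: (@sub_finite_set _ _ ((fun i : nat => qz_class (i%:R / q%:R)) @` `I_q)).
  move=> _ [n _ <-]; exists (n * a %% q)%N; first by rewrite /= ltn_pmod.
  rewrite /qz_muln tE mulrA -natrM {2}(divn_eq (n * a) q) natrD mulrDl addrC.
  rewrite natrM mulfK ?pnatr_eq0 -?lt0n//.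
  by set k := (_ %/ _)%N; rewrite -[k%:R]/(k%:Z%:~R) qz_classDz.
exact/finite_image/finite_II.
Qed.

Lemma qz_preperiodic d t :
  exists m p, iter p.+1 (qz_muln d) (iter m (qz_muln d) t) = iter m (qz_muln d) t.
Proof.
pose f n := qz_muln (d ^ n) t.
have [inj|/existsNP[m /existsNP[n]]] := pselect (injective f).
  have : infinite_set (range f).
    apply/infiniteP.
    by have := @inj_card_eq _ _ setT f (in2W inj); rewrite card_eq_le => /andP[].
  case; apply: sub_finite_set (qz_muln_finite t).
  by move=> _ [n _ <-]; exists (d ^ n)%N.
wlog lmn : m n / (m < n)%N.
  move=> h /[dup] fmn /not_implyP[e] /eqP.
  rewrite neq_ltn => /orP[mn|nm]; first exact: (h _ _ mn).
  by apply: (h _ _ nm) => /(_ (esym e)) nme; apply: fmn.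
move=> /not_implyP[e _]; exists m, (n - m.+1)%N.
by rewrite -iterD -!qz_mulnX -[RHS]/(f m) e /f; congr (qz_muln (_ ^ _) _); lia.
Qed.

Lemma exprn_mul_gt1 d (x : rat) : (1 < d)%N -> 0 < x ->
  exists n, 1 < d%:R ^+ n * x.
Proof.
move=> d1 x0; exists (Num.bound x^-1).
rewrite -ltr_pdivrMr// div1r (lt_le_trans (upper_nthrootP (leqnn _)))//.
by rewrite lerXn2r ?nnegrE// ?ler_nat.
Qed.

Definition digit d t : nat := Num.truncn (d%:R * qz_val t).

Lemma digit_lt d t : (0 < d)%N -> (digit d t < d)%N.
Proof.
move=> d0; rewrite /digit truncn_lt_nat ?mulr_ge0 ?qz_val_ge0//.
by rewrite gtr_pMr ?qz_val_lt1// ltr0n.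
Qed.

Lemma digitE d t : d%:R * qz_val t = (digit d t)%:R + qz_val (qz_muln d t).
Proof.
rewrite /digit truncn_floor mulr_ge0 ?qz_val_ge0//= natr_absz ger0_norm.
  by rewrite addrC subrK.
by rewrite floor_ge0 mulr_ge0 ?qz_val_ge0.
Qed.

Lemma digit_surj d a : (a < d)%N -> exists t, digit d t = a.
Proof.
move=> ad; have d0 : 0 < d%:R :> rat by rewrite ltr0n (leq_ltn_trans _ ad).
have ad1 : 0 <= (a%:R / d%:R : rat) < 1.
  by rewrite divr_ge0//= ltr_pdivrMr// mul1r ltr_nat.
by exists (MkQZ ad1); rewrite /digit /= mulrC divfK ?gt_eqF// natrK.
Qed.

(** * Renaming the digits of an expansion *)

Section Recoding.
Variables (d B : nat) (e : nat -> nat).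
Hypothesis d_gt1 : (1 < d)%N.
Hypothesis e_lt : forall a, (a < d)%N -> (e a < B)%N.
Hypothesis e_mono : forall a b, (a < b < d)%N -> (e a < e b)%N.

Let B_gt1 : (1 < B)%N.
Proof.
have e01 : (e 0 < e 1)%N by rewrite e_mono.
by rewrite (leq_ltn_trans _ (e_lt d_gt1)) ?(leq_ltn_trans _ e01).
Qed.

Let f := qz_muln d.
Let c t : rat := (e (digit d t))%:R.

Let B0 : 0 < B%:R :> rat. Proof. by rewrite ltr0n ltnW. Qed.

Let BVn_gt0 n : 0 < B%:R ^- n :> rat.
Proof. by rewrite invr_gt0 exprn_gt0. Qed.

Let c_bound t : 0 <= c t <= B%:R - 1.
Proof.
have := e_lt (digit_lt t (ltnW d_gt1)); rewrite ler0n /= lerBrDr natr1.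
by rewrite ler_nat.
Qed.

(** [w] is the value in base [B] of the expansion of [t] with each digit renamed
    by [e]; [u n] is then the value of the expansion with [n] digits dropped.
    The bounds on [u] exclude the other solutions of the recursion, which grow
    like [B ^ n]. *)
Definition recoded t (w : rat) : Prop :=
  exists u : nat -> rat, [/\ u 0%N = w, forall n, 0 <= u n <= 1 &
    forall n, B%:R * u n = c (iter n f t) + u n.+1].

Lemma recoded_unique t w w' : recoded t w -> recoded t w' -> w = w'.
Proof.
move=> [u [<- ub uE]] [v [<- vb vE]].
have uv n : `|u 0%N - v 0%N| <= B%:R ^- n.
  suff -> : u 0%N - v 0%N = B%:R ^- n * (u n - v n).
    rewrite normrM [`|_ ^- _|]ger0_norm ?(ltW (BVn_gt0 _))//.
    rewrite ler_piMr ?(ltW (BVn_gt0 _))//.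
    by move: (ub n) (vb n); rewrite ler_norml; lra.
  elim: n => [|n IH]; first by rewrite expr0 invr1 mul1r.
  have -> : u n.+1 - v n.+1 = B%:R * (u n - v n) by move: (uE n) (vE n); lra.
  by rewrite IH exprSr invfM mulrA mulfVK ?gt_eqF// -mulrA.
apply/eqP; rewrite -subr_eq0 -normr_le0 leNgt; apply/negP => uv0.
have [|n] := @exprn_mul_gt1 B `|u 0%N - v 0%N| B_gt1; first exact: uv0.
by rewrite ltNge -ler_pdivlMl ?exprn_gt0// mulr1 uv.
Qed.

Lemma recoded_tail t w : recoded t w ->
  exists2 w', recoded (f t) w' & B%:R * w = c t + w'.
Proof.
move=> [u [<- ub uE]]; exists (u 1%N); last exact: (uE 0%N).
by exists (u \o succn); split => // n /=; [exact: ub | rewrite uE -iterSr].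
Qed.

Lemma recoded_cons t w : recoded (f t) w -> recoded t ((c t + w) / B%:R).
Proof.
move=> [u [<- ub uE]].
exists (fun n => if n is n'.+1 then u n' else (c t + u 0%N) / B%:R).
split => // -[|n] //.
- rewrite ler_pdivlMr// ler_pdivrMr// mul0r mul1r.
  by move: (c_bound t) (ub 0%N); lra.
- by rewrite mulrC divfK ?gt_eqF.
- by rewrite uE -iterSr.
Qed.

Let psum n t : rat := \sum_(i < n) c (iter i f t) / B%:R ^+ i.+1.

Let psum_head n t : B%:R * psum n.+1 t = c t + psum n (f t).
Proof.
rewrite /psum big_ord_recl mulrDr/= expr1 mulrC divfK ?gt_eqF//; congr (_ + _).
rewrite mulr_sumr; apply: eq_bigr => i _.
by rewrite -iterSr exprS invfM mulrCA mulVKf ?gt_eqF.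
Qed.

Let psum_last n t : psum n.+1 t = psum n t + c (iter n f t) / B%:R ^+ n.+1.
Proof. by rewrite /psum big_ord_recr. Qed.

Let psum_bound n t : 0 <= psum n t <= 1 - B%:R ^- n.
Proof.
elim: n t => [|n IH] t; first by rewrite /psum big_ord0 expr0 invr1 subrr lexx.
have h := psum_head n t; have := c_bound t; have := IH (f t).
have hB : B%:R * B%:R ^- n.+1 = B%:R ^- n :> rat.
  by rewrite exprS invfM mulVKf ?gt_eqF.
move=> hn hc; apply/andP; split; first by rewrite -(pmulr_rge0 _ B0) h; lra.
by rewrite -(ler_pM2l B0) mulrBr mulr1 hB h; lra.
Qed.

(** If [t] has period [p + 1] then the tails have values [u n] equal to the first
    [p + 1] terms of the series, summed geometrically over the periods. *)
Lemma recoded_periodic t p : iter p.+1 f t = t -> exists w, recoded t w.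
Proof.
move=> per; pose D : rat := 1 - B%:R ^- p.+1.
have D0 : 0 < D.
  by rewrite subr_gt0 invf_lt1 ?exprn_gt0// exprn_egt1// ltr1n.
pose u n := psum p.+1 (iter n f t) / D.
exists (u 0%N), u; split => // n.
  rewrite ler_pdivlMr// ler_pdivrMr// mul0r mul1r; exact: psum_bound.
have perE : iter p f (iter n.+1 f t) = iter n f t.
  by rewrite -iterD addnC addSnnS iterD per.
rewrite /u mulrA psum_head -iterS psum_last perE.
apply: (@mulIf _ D); first by rewrite gt_eqF.
rewrite [RHS]mulrDl !divfK ?gt_eqF// /D mulrBr mulr1.
by ring.
Qed.

Lemma recoded_exists t : exists w, recoded t w.
Proof.
have [m [p per]] := qz_preperiodic d t.
elim: m t per => [|m IH] t per; first exact: recoded_periodic per.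
have [|w rw] := IH (f t); first by rewrite -(iterSr m f t).
by exists ((c t + w) / B%:R); apply: recoded_cons.
Qed.

Let w t : rat := sval (cid (recoded_exists t)).

Let wP t : recoded t (w t). Proof. exact: svalP (cid _). Qed.

Let wE t : B%:R * w t = c t + w (f t).
Proof.
have [w' rw' ->] := recoded_tail (wP t).
by rewrite (recoded_unique rw' (wP _)).
Qed.

Let w_bound t : 0 <= w t <= 1.
Proof. by have [u [<- ub _]] := wP t. Qed.

(* [w t = 1] would force every renamed digit to be [B - 1], hence every digit of
   [t] to be [d - 1].  Then multiplication by [d] would always expand the distance
   from [t] to 1 by the factor [d], although that distance is at most 1; this
   is the induction on [n]. *)
Let w_lt1 t : w t < 1.
Proof.
have [n] := exprn_mul_gt1 d_gt1 (etrans (subr_gt0 _ _) (qz_val_lt1 t)).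
elim: n t => [|n IH] t.
  by rewrite expr0 mul1r => ?; have := qz_val_ge0 t; lra.
move=> ht; case/andP: (w_bound t) => _; rewrite le_eqVlt => /orP[/eqP wt1|//].
have [cb wb wtE] := And3 (c_bound t) (w_bound (f t)) (wE t).
have wft1 : w (f t) = 1 by move: wtE; rewrite wt1; lra.
have etop : e (digit d t) = B.-1.
  suff /eqP : (e (digit d t)).+1%:R == B%:R :> rat.
    by move=> /eqP; rewrite eqr_nat => /eqP <-.
  by apply/eqP; rewrite -natr1; move: wtE; rewrite /c wt1; lra.
have dtop : digit d t = d.-1.
  have := digit_lt t (ltnW d_gt1) => dlt.
  case: (ltngtP (digit d t) d.-1); [|lia|by []] => dd.
  have := e_mono (a := digit d t) (b := d.-1); have := @e_lt d.-1.
  by rewrite etop; lia.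
suff : w (f t) < 1 by rewrite wft1 ltxx.
have dE : (digit d t)%:R + 1 = d%:R :> rat by rewrite natr1 dtop prednK// ltnW.
have tE : d%:R * qz_val t = (digit d t)%:R + qz_val (f t) := digitE d t.
apply: IH; have -> : 1 - qz_val (f t) = d%:R * (1 - qz_val t)
  by rewrite mulrBr tE -dE; ring.
by rewrite mulrA -exprSr.
Qed.

Definition recode t : QZ :=
  MkQZ (introT andP (conj (proj1 (andP (w_bound t))) (w_lt1 t))).

Lemma recodeE t : B%:R * qz_val (recode t) =
  (e (digit d t))%:R + qz_val (recode (qz_muln d t)).
Proof. exact: wE. Qed.

Lemma recode_qz_muln t : recode (qz_muln d t) = qz_muln B (recode t).
Proof.
apply: qz_val_inj => /=; rewrite wE (floor_def (m := e (digit d t))).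
  by rewrite [w (f t)]/w; rewrite addrC addKr.
by rewrite rmorphD/= lerDl ltrD2l w_lt1; case/andP: (w_bound (f t)) => ->.
Qed.

(** Equal leading digits cancel, and removing them multiplies [t - s] by [d]; as
    long as the digits agree this goes on, but differences stay below 1, so
    after finitely many steps the leading digits differ.  Then
    [recode s] and [recode t] compare like these digits, since the rest of an
    expansion contributes less than one unit of the digit. *)
Lemma recode_lt : {homo recode : s t / (s < t)%O}.
Proof.
move=> s t; rewrite !lt_qz => lst.
have [n] := exprn_mul_gt1 d_gt1 (etrans (subr_gt0 _ _) lst).
elim: n s t lst => [|n IH] s t lst.
  rewrite expr0 mul1r => ?.
  by have := qz_val_ge0 s; have := qz_val_lt1 t; lra.
move=> hst; have [Es Et] := (digitE d s, digitE d t).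
have [ws wt] := (recodeE s, recodeE t).
rewrite -(ltr_pM2l B0) ws wt.
case: (ltngtP (digit d s) (digit d t)) => dd.
- have : (e (digit d s)).+1%:R <= (e (digit d t))%:R :> rat.
    by rewrite ler_nat e_mono// dd digit_lt// ltnW.
  have := qz_val_lt1 (recode (qz_muln d s)).
  have := qz_val_ge0 (recode (qz_muln d t)).
  by rewrite -natr1; lra.
- have : (digit d t).+1%:R <= (digit d s)%:R :> rat by rewrite ler_nat.
  have := qz_val_lt1 (qz_muln d t); have := qz_val_ge0 (qz_muln d s).
  have : 0 < d%:R * (qz_val t - qz_val s) by rewrite mulr_gt0 ?subr_gt0// ltr0n ltnW.
  by rewrite mulrBr -natr1; lra.
have dE : qz_val (qz_muln d t) - qz_val (qz_muln d s)
        = d%:R * (qz_val t - qz_val s) by rewrite mulrBr Es Et dd; ring.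
rewrite dd ltrD2l IH// ?dE -1?subr_gt0 ?dE ?mulr_gt0 ?subr_gt0 ?ltr0n ?(ltnW d_gt1)//.
by rewrite mulrA -exprSr.
Qed.

Lemma recode_iter n t : recode (iter n (qz_muln d) t) = iter n (qz_muln B) (recode t).
Proof. by elim: n => //= n <-; rewrite recode_qz_muln. Qed.

End Recoding.

(** * The legs of a spider *)

Section Legs.
Variable R : realType.
Implicit Types (r : R) (p : (R * R)%type) (z : riemann_sphere R).

Let ang t : R := 2 * pi * ratr (qz_val t).
Let ct t : R := cos (ang t).
Let st t : R := sin (ang t).

Let ctst1 t : ct t ^+ 2 + st t ^+ 2 = 1.
Proof. exact: cos2Dsin2. Qed.

(** [cos (x - y) = 1] makes [sin] vanish at half of [|x - y|], a point of
    [0, pi), where 0 is the only zero. *)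
Lemma cossin_inj (x y : R) : `|x - y| < 2 * pi ->
  cos x = cos y -> sin x = sin y -> x = y.
Proof.
move=> xy cxy sxy; apply/eqP; rewrite -subr_eq0 -normr_eq0.
have : cos `|x - y| = 1 by rewrite cos_norm cosB cxy sxy -!expr2 cos2Dsin2.
move: xy (normr_ge0 (x - y)); move: `|x - y| => a a2 a0 ca.
rewrite eq_le a0 andbT leNgt; apply/negP => a_gt0.
have : 0 < sin (a / 2).
  by apply: sin_gt0_pi; rewrite divr_gt0//= ltr_pdivrMr// mulrC.
have : sin (a / 2) ^+ 2 = 0.
  have := cos_mulr2n (a / 2); rewrite [a / 2 *+ 2]mulr2n -splitr ca.
  by have := cos2Dsin2 (a / 2); rewrite mulr2n; lra.
by move=> /eqP; rewrite sqrf_eq0 => /eqP ->; rewrite ltxx.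
Qed.

Let unit_inj s t : ct s = ct t -> st s = st t -> s = t.
Proof.
move=> ce se; have : ang s = ang t.
  apply: cossin_inj => //; rewrite /ang -mulrBr normrM ger0_norm ?mulr_ge0 ?pi_ge0//.
  rewrite gtr_pMr ?mulr_gt0 ?pi_gt0// -rmorphB/=.
  rewrite -ratr_norm -(rmorph1 (ratr : rat -> R)) ltr_rat ltr_norml.
  have := qz_val_ge0 s; have := qz_val_ge0 t.
  by have := qz_val_lt1 s; have := qz_val_lt1 t; lra.
have pi0 : 2 * pi != 0 :> R by rewrite mulf_neq0// gt_eqF// pi_gt0.
by move=> /(mulfI pi0) /(fmorph_inj (ratr : rat -> R)) /qz_val_inj.
Qed.

Lemma polar_pt_fin r t : polar_pt r%:E t = Some (r * ct t, r * st t).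
Proof. by []. Qed.

Lemma polar_pt_inj r r' s t : 0 < r -> 0 <= r' ->
  polar_pt r%:E s = polar_pt r'%:E t -> s = t /\ r = r'.
Proof.
move=> r0 r'0; rewrite !polar_pt_fin => -[ce se].
have rr' : r = r'.
  apply/eqP; rewrite -(@eqrXn2 _ 2)// ?ltW//; apply/eqP.
  transitivity ((r * ct s) ^+ 2 + (r * st s) ^+ 2).
    by rewrite !exprMn -mulrDr ctst1 mulr1.
  by rewrite ce se !exprMn -mulrDr ctst1 mulr1.
split => //; move: ce se.
rewrite -rr' => /(mulfI (lt0r_neq0 r0)) ? /(mulfI (lt0r_neq0 r0)).
exact: unit_inj.
Qed.

Definition orbit_pts d t : set QZ := range (fun n => qz_muln (d ^ n) t).

Definition inner_angle d t s : Prop :=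
  exists2 k, is_period d t k & s = qz_muln (d ^ k.-1) t.

Lemma is_period_unique d t k l : is_period d t k -> is_period d t l -> k = l.
Proof.
move=> [k0 kt kmin] [l0 lt lmin]; case: (ltngtP k l) => // kl; exfalso.
  by apply: (lmin k) => //; rewrite k0.
by apply: (kmin l) => //; rewrite l0.
Qed.

Lemma inner_angle_unique d t s s' :
  inner_angle d t s -> inner_angle d t s' -> s = s'.
Proof. by move=> [k pk ->] [l pl ->]; rewrite (is_period_unique pk pl). Qed.

(** The radius at which the leg of angle [s] starts. *)
Definition foot d t s : R := if `[< inner_angle d t s >] then 0 else 1.

Lemma foot_ge0 d t s : 0 <= foot d t s.
Proof. by rewrite /foot; case: ifP. Qed.

Lemma foot_le1 d t s : foot d t s <= 1.
Proof. by rewrite /foot; case: ifP. Qed.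

Lemma spider_finE d t : @spider R d t `\ infinity_pt R =
  [set z | exists s r, [/\ orbit_pts d t s, foot d t s <= r & z = polar_pt r%:E s]].
Proof.
apply/seteqP; split => [z [[]]|].
- move=> [j [[r||]]] [j1 r1 ->] // zfin; last by case: zfin.
  exists (qz_muln (d ^ j.-1) t), r; split => //; first by exists j.-1.
  exact: le_trans (foot_le1 _ _ _) r1.
- move=> [k [[r||]]] [kper /andP[r0 r1] ->] // zfin.
  exists (qz_muln (d ^ k.-1) t), r; split => //; first by exists k.-1.
  by rewrite /foot; case: asboolP => // -[]; exists k.
move=> z [s [r [[n _ <-] rs ->]]]; split => //.
have [r1|/ltW r1] := leP 1 r; first by left; exists n.+1, r%:E.
move: rs; rewrite /foot; case: asboolP => [[k kper kn] r0|_ r1']; last first.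
  by left; exists n.+1, r%:E.
by right; exists k, r%:E; rewrite -kn; split => //; rewrite !lee_fin r0.
Qed.

(** The equation selects the line of direction [s]; on it the second quantity is the
    signed distance to the origin.  Given by continuous functions on the plane,
    this half-line is visibly closed. *)
Definition ray (a : R) s : set (R * R)%type :=
  [set p | p.1 * st s = p.2 * ct s /\ a <= p.1 * ct s + p.2 * st s].

Lemma rayP a s p : ray a s p <-> exists2 r, a <= r & p = (r * ct s, r * st s).
Proof.
have h := ctst1 s; split => [[cr dot]|[r ar ->]]; last first.
  split => /=; first by rewrite -!mulrA [ct s * _]mulrC.
  by rewrite -!mulrA -mulrDr -!expr2 h mulr1.
exists (p.1 * ct s + p.2 * st s) => //; rewrite [LHS]surjective_pairing.
congr pair.
  transitivity (p.1 * (ct s ^+ 2 + st s ^+ 2)); first by rewrite h mulr1.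
  rewrite mulrDr !expr2 !mulrA cr; ring.
transitivity (p.2 * (ct s ^+ 2 + st s ^+ 2)); first by rewrite h mulr1.
by rewrite mulrDr !expr2 !mulrA -cr; ring.
Qed.

Lemma ray_closed a s : closed (ray a s).
Proof.
have cf : continuous (fun p : R * R => p.1 * st s - p.2 * ct s).
  move=> p; apply: cvgB; apply: cvgM;
    [exact: cvg_fst|exact: cvg_cst|exact: cvg_snd|exact: cvg_cst].
have cg : continuous (fun p : R * R => p.1 * ct s + p.2 * st s).
  move=> p; apply: cvgD; apply: cvgM;
    [exact: cvg_fst|exact: cvg_cst|exact: cvg_snd|exact: cvg_cst].
have -> : ray a s = (fun p : R * R => p.1 * st s - p.2 * ct s) @^-1` [set 0]
   `&` (fun p : R * R => p.1 * ct s + p.2 * st s) @^-1` [set x | a <= x].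
  apply/seteqP; split => p /= [h1 h2]; split => //; first by rewrite h1 subrr.
  exact: subr0_eq.
by apply: closedI; apply: closed_comp.
Qed.


(** Half-lines of distinct angles can only meet at the origin, and only the leg of
    the inner angle reaches it. *)
Lemma ray_disjoint d t s s' p :
  ray (foot d t s) s p -> ray (foot d t s') s' p -> s = s'.
Proof.
move=> /rayP[r sr pr] /rayP[r' sr' pr'].
have r0 := le_trans (foot_ge0 _ _ _) sr.
have r'0 := le_trans (foot_ge0 _ _ _) sr'.
have E : polar_pt r%:E s = polar_pt r'%:E s' by rewrite !polar_pt_fin -pr -pr'.
have [rr|rr|rr] := ltgtP 0 r.
- by have [] := polar_pt_inj rr r'0 E.
- by move: rr; rewrite ltNge r0.
have [rr'|rr'|rr'] := ltgtP 0 r'.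
- by have [] := polar_pt_inj rr' r0 (esym E).
- by move: rr'; rewrite ltNge r'0.
move: sr sr'; rewrite -rr -rr' /foot.
case: asboolP => [hs _|_]; last by rewrite ler10.
case: asboolP => [hs' _|_]; last by rewrite ler10.
exact: inner_angle_unique hs hs'.
Qed.

Lemma orbit_pts_finite d t : finite_set (orbit_pts d t).
Proof.
apply: sub_finite_set (qz_muln_finite t).
by move=> _ [n _ <-]; exists (d ^ n)%N.
Qed.

(** Each leg is open and closed in the union of the legs: the others are finitely
    many disjoint closed sets.  Inside the sphere, where the legs accumulate at
    infinity, closed sets of the plane enter through their open complements. *)
Lemma connected_sub_ray d t s (C : set (riemann_sphere R)) :
  orbit_pts d t s -> connected C -> C `<=` @spider R d t `\ infinity_pt R ->
  C `&` (Some @` ray (foot d t s) s) !=set0 -> C `<=` Some @` ray (foot d t s) s.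
Proof.
move=> ots cC; rewrite spider_finE => CS C0.
pose K s' := ray (foot d t s') s'.
pose U := ~` \bigcup_(s' in orbit_pts d t `\ s) K s'.
have oU : open U.
  apply: closed_openC; apply: closed_bigcup => [|s' _]; last exact: ray_closed.
  exact: sub_finite_set (orbit_pts_finite d t).
apply/setIidPl; apply: cC => //.
  exists (Some @` U); first exact: one_point_compactification_open_some.
  apply/seteqP; split => z [Cz [p ps pz]]; split => //; exists p => //.
    by move=> [s' [_ s's] ps']; apply: s's; exact: ray_disjoint ps' ps.
  have [s' [r [os' rs' zr]]] := CS _ Cz.
  have ps' : K s' p.
    by apply/rayP; exists r => //; move: zr; rewrite -pz => -[].
  have [<-//|ss'] := pselect (s' = s).
  by case: ps; exists s'.
exists (~` (Some @` ~` K s)).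
  apply: open_closedC; apply: one_point_compactification_open_some.
  exact/closed_openC/ray_closed.
apply/seteqP; split => z [Cz].
  by move=> [p ps pz]; split => // -[q nq]; rewrite -pz => -[qp]; apply: nq; rewrite qp.
move=> nz; split => //; have [s' [r [_ _ zr]]] := CS _ Cz.
exists (r * ct s', r * st s') => //.
by apply: contrapT => nK; apply: nz; exists (r * ct s', r * st s').
Qed.

Lemma polar_pt_continuous s :
  continuous (fun r => polar_pt r%:E s : riemann_sphere R).
Proof.
move=> r; pose g x : (R * R)%type := (x * ct s, x * st s).
have cg : {for r, continuous g}.
  have hc (a : R) : x * a @[x --> r] --> r * a.
    by apply: cvgM; [exact: cvg_id|exact: cvg_cst].
  exact: (cvg_pair (hc (ct s)) (hc (st s))).
exact: continuous_comp cg (@one_point_compactification_some_continuous _ _).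
Qed.

(** The segment of the leg between radius [r] and radius 1 is connected. *)
Lemma component_polar d t s r : orbit_pts d t s -> foot d t s <= r ->
  let S := @spider R d t `\ infinity_pt R in
  connected_component S (polar_pt r%:E s) = connected_component S (polar_pt 1%:E s).
Proof.
move=> os sr S; apply: same_connected_component.
pose lo := Num.min r 1; pose hi := Num.max r 1.
apply: (@connected_component_max _ _ ((fun r => polar_pt r%:E s) @` `[lo, hi])).
- by exists r => //=; rewrite in_itv/= /lo /hi ge_min lexx le_max lexx.
- move=> _ [x /= xI <-]; rewrite /S spider_finE; exists s, x; split => //.
  move: xI; rewrite in_itv/= => /andP[+ _]; apply: le_trans.
  by rewrite le_min sr foot_le1.
- apply: connected_continuous_connected; first exact: segment_connected.
  by apply: continuous_subspaceT; exact: polar_pt_continuous.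
- by exists 1 => //=; rewrite in_itv/= /lo /hi ge_min lexx le_max lexx !orbT.
Qed.

Let unit_pt_in d t s : orbit_pts d t s ->
  (@spider R d t `\ infinity_pt R) (polar_pt 1%:E s).
Proof.
by move=> os; rewrite spider_finE; exists s, 1; split => //; exact: foot_le1.
Qed.

Lemma legs_card_orbit d t : (@legs R d t #= orbit_pts d t)%card.
Proof.
pose S := @spider R d t `\ infinity_pt R.
have -> : @legs R d t =
    (fun s => connected_component S (polar_pt 1%:E s)) @` orbit_pts d t.
  apply/seteqP; split => [_ [z zS <-]|_ [s os <-]]; last first.
    by exists (polar_pt 1%:E s); first exact (unit_pt_in os).
  move: (zS); rewrite {1}spider_finE => -[s [r [os sr zE]]].
  by exists s => //; rewrite zE /S (component_polar os sr).
apply: inj_card_eq => s s'; rewrite !inE => os os' ss'.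
have : connected_component S (polar_pt 1%:E s) (polar_pt 1%:E s').
  by rewrite ss'; exact: connected_component_refl (unit_pt_in os').
have h x : orbit_pts d t x -> ray (foot d t x) x (1 * ct x, 1 * st x).
  by move=> ox; apply/rayP; exists 1 => //; exact: foot_le1.
move/(connected_sub_ray os (@component_connected _ _ _) (@connected_component_sub _ _ _)).
case.
  exists (polar_pt 1%:E s); split; first exact: connected_component_refl (unit_pt_in os).
  by exists (1 * ct s, 1 * st s) => //; apply: h.
by move=> p ps [pE]; apply: (ray_disjoint ps); rewrite pE; exact: h.
Qed.

Lemma leg_angles_orbit d t : leg_angles R d t = orbit_pts d t.
Proof.
apply/seteqP; split => [s [_ [z _ <-]] /connected_component_sub|s os].
  rewrite spider_finE => -[s' [r [os' sr E]]].
  by have [->] := polar_pt_inj ltr01 (le_trans (foot_ge0 _ _ _) sr) E.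
exists (connected_component (@spider R d t `\ infinity_pt R) (polar_pt 1%:E s)).
  by exists (polar_pt 1%:E s); first exact (unit_pt_in os).
exact: connected_component_refl (unit_pt_in os).
Qed.

(** Legs correspond to orbit angles, so an increasing map that carries one orbit to
    the other, respecting time, transports listings of the legs and their order;
    sortedness of a rotation is preserved because rotation commutes with maps. *)
Lemma spider_isomorphic_conj d d' t t' (h : QZ -> QZ) :
  {homo h : x y / (x < y)%O} ->
  (forall n, h (qz_muln (d ^ n) t) = qz_muln (d' ^ n) t') ->
  spider_isomorphic R d t d' t'.
Proof.
move=> h_lt hE.
have h_inj : injective h := inc_inj (le_mono h_lt).
have orbE : orbit_pts d' t' = h @` orbit_pts d t.
  by rewrite image_comp; apply: eq_imagel => n _ /=; rewrite hE.
split.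
  have [r tr] := orbit_pts_finite d t; exists r; split.
    exact: card_eq_trans (legs_card_orbit d t) tr.
  apply: card_eq_trans (legs_card_orbit d' t') _; rewrite orbE.
  by apply: card_eq_trans tr; apply: inj_card_eq; exact: in2W.
move=> ns [ns1 nsE [i si]].
have mapE : [seq orbit_angle d' t' n | n <- ns] =
    map h [seq orbit_angle d t n | n <- ns].
  by rewrite -map_comp; apply: eq_map => n /=; rewrite /orbit_angle hE.
split => //.
  rewrite leg_angles_orbit orbE -leg_angles_orbit nsE mapE.
  apply/seteqP; split => [_ [x /= xs <-]|x /= /mapP[y ys ->]]; first exact: map_f.
  by exists y.
exists i; rewrite mapE -map_rot sorted_map; apply: sub_sorted si.
exact: h_lt.
Qed.

End Legs.

(** * Skipping a digit *)

Lemma bump_ltS d j a : (a < d)%N -> (bump j a < d.+1)%N.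
Proof. by rewrite /bump; lia. Qed.

Lemma bump_lt d j a b : (a < b < d)%N -> (bump j a < bump j b)%N.
Proof. by rewrite /bump; lia. Qed.

Definition skip_digit d (d_gt1 : (1 < d)%N) (j : nat) : QZ -> QZ :=
  recode d_gt1 (@bump_ltS d j) (@bump_lt d j).

(** If the two maps agreed, then at an angle with leading digit [i] the remaining
    digits would contribute the same amount to both values, so the renamed
    leading digits would agree; but they are [i + 1] and [i]. *)
Lemma skip_digit_neq d (d_gt1 : (1 < d)%N) i j : (i < j)%N -> (i < d)%N ->
  skip_digit d_gt1 i <> skip_digit d_gt1 j.
Proof.
move=> ij id eij; have [t dt] := digit_surj id.
have ti := recodeE d_gt1 (@bump_ltS d i) (@bump_lt d i) t.
have tj := recodeE d_gt1 (@bump_ltS d j) (@bump_lt d j) t.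
rewrite -/(skip_digit d_gt1 i) -/(skip_digit d_gt1 j) -eij in ti tj.
have : bump i i = bump j i.
  by apply/eqP; rewrite -(eqr_nat rat); apply/eqP; move: ti tj; rewrite dt; lra.
by rewrite /bump; lia.
Qed.

Theorem lemma1p1 (R : realType) (d : nat) (hd : (2 <= d)%N) :
  exists Z : 'I_d -> QZ -> QZ,
    injective Z /\
    forall j : 'I_d,
      [/\ injective (Z j),
          {homo Z j : s t / (s <= t)%O} &
          forall theta : QZ,
            spider_isomorphic R d theta d.+1 (Z j theta)].
Proof.
exists (fun j => skip_digit hd j); split => [i j eij|j].
  apply/val_inj => /=; case: (ltngtP i j) => // ij; exfalso.
    exact: skip_digit_neq ij (ltn_ord i) eij.
  exact: skip_digit_neq ij (ltn_ord j) (esym eij).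
have Zlt : {homo skip_digit hd j : s t / (s < t)%O} by exact: recode_lt.
split; [exact: inc_inj (le_mono Zlt) | exact: ltW_homo | move=> theta].
by apply: (spider_isomorphic_conj R Zlt) => n; rewrite !qz_mulnX; exact: recode_iter.
Qed.
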